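(* Let $\eta$ be a probability measure on $[0,1]$ and let $L_\eta$ be the operator, acting on the space of probability measures on $[0,1]$, which associates to $m$ the probability measure $m'$ defined by $F_{m'}=K\circ F_m^{-1}$. 1. The operator $L_\eta$ preserves the first moment of the probability (i.e. $\int_0^1 t\,m(dt)=\int_0^1 t\,m'(dt)$ for all $m$) if and only if the probability $\eta$ is uniform on $[0,1]$. 2. If the probability $\eta$ is uniform, then the operator $L_\eta$ is its own inverse, meaning that $(m')'=m$.
   Context: For a probability measure $m$ on $[0,1]$, $F_m$ denotes the function $F_m(\alpha)=m((\alpha,1])$, $\alpha\in[0,1]$ (its tail distribution function). Generalized inverse: for a decreasing (non-increasing) right continuous function $S$ on $[0,1]$ with $S(0)\le1$ and $S(1)=0$, one sets, for all $t\in[0,1]$, $S^{-1}(t)=\sup\{\alpha\in[0,1]:S(\alpha)>t\}$ (the supremum being taken in $[0,1]$, so that the supremum of the empty set is $0$). $F_m^{-1}$ is the generalized inverse of $F_m$ in this sense. $K$ denotes the cumulative distribution function of $\eta$: $K(u)=\eta([0,u])$ for all $u\in[0,1]$.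
   Formalization: In part 1, ''the operator preserves the first moment'' includes that m' exists for every m; for η with atoms (e.g. η a unit mass at 0, where K∘F_m^{-1} equals 1 at 1) the formula need not define a probability measure; existence for uniform η is part of the conclusion. *)

(* Defs.v *)
From HB Require Import structures.
From mathcomp Require Import all_boot all_order all_algebra.
From mathcomp Require Import all_classical all_reals all_analysis.

Set Implicit Arguments.
Unset Strict Implicit.
Unset Printing Implicit Defensive.

Import Order.TTheory GRing.Theory Num.Theory.
Import numFieldNormedType.Exports.
Local Open Scope classical_set_scope.
Local Open Scope ring_scope.

(* A probability measure on [0,1] is a Borel probability measure on the line
   which is carried by [0,1]. *)
Definition on01 (R : realType) (m : probability (measurableTypeR R) R) : Prop :=
  m `[0, 1]%classic = 1%E.

(* In the library a measure is a function on all sets, whose values outside the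
   sigma-algebra are irrelevant: Leibniz equality would be too strong. *)
Definition same_law (R : realType)
    (m1 m2 : set (measurableTypeR R) -> \bar R) : Prop :=
  forall A : set (measurableTypeR R), measurable A -> m1 A = m2 A.

Definition uniform01 (R : realType) (eta : probability (measurableTypeR R) R)
    : Prop :=
  same_law eta (uniform_prob (@ltr01 R)).

Definition tail (R : realType) (m : probability (measurableTypeR R) R) (a : R)
    : R :=
  fine (m `]a, 1]%classic).

Definition cdf01 (R : realType) (eta : probability (measurableTypeR R) R) (u : R)
    : R :=
  fine (eta `[0, u]%classic).

(* [sup set0 = 0] in the library, in accordance with the convention that the
   supremum is taken in [0,1]. *)
Definition geninv (R : realType) (S : R -> R) (t : R) : R :=
  sup [set a : R | 0 <= a <= 1 /\ t < S a].

(* Graph of the operator attached to eta: m is mapped to m'. The measure m' is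
   unique up to [same_law] if it exists. If eta has an atom, then the right-hand
   side may fail to be right continuous or to vanish at 1, so that m' need not
   exist for every m. *)
Definition Lrel (R : realType) (eta m m' : probability (measurableTypeR R) R)
    : Prop :=
  on01 m' /\
  forall t : R, 0 <= t <= 1 -> tail m' t = cdf01 eta (geninv (tail m) t).

Definition Ldefined (R : realType) (eta : probability (measurableTypeR R) R)
    : Prop :=
  forall m : probability (measurableTypeR R) R, on01 m ->
    exists m' : probability (measurableTypeR R) R, Lrel eta m m'.

Definition first_moment (R : realType) (m : probability (measurableTypeR R) R)
    : \bar R :=
  (\int[m]_(t in `[0%R, 1%R]) t%:E)%E.

(* Main.v *)
(* For uniform eta, m' is the law of F_m(U) with U uniform on [0,1]: the set
   {a | t < F_m a} is an initial segment of [0,1], so its Lebesgue measure is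
   its supremum F_m^{-1}(t). The first moment of m' is then the integral of F_m
   over [0,1], which is the first moment of m. Right continuity of F_m gives
   t < F_m^{-1}(a) <-> a < F_m(t), so (F_m^{-1})^{-1} = F_m on [0,1], and a law on
   [0,1] is determined by its tail. Conversely, testing the preservation of the
   first moment on the Dirac mass at x forces K(x) = x. *)
Require Import Defs.
From HB Require Import structures.
From mathcomp Require Import all_boot all_order all_algebra.
From mathcomp Require Import all_classical all_reals all_analysis.
From mathcomp Require Import measurable_realfun.

Set Implicit Arguments.
Unset Strict Implicit.
Unset Printing Implicit Defensive.

Import Order.TTheory GRing.Theory Num.Theory.
Import numFieldNormedType.Exports.
Local Open Scope classical_set_scope.
Local Open Scope ring_scope.

(** * Laws carried by [0,1] and their tails *)

Lemma on01_setI (R : realType) (m : probability (measurableTypeR R) R)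
    (A : set R) : on01 m -> measurable A -> m (A `&` `[0, 1]%classic) = m A.
Proof.
move=> hm mA; have mI : measurable (`[0, 1]%classic : set (measurableTypeR R)).
  exact: measurable_itv.
rewrite [RHS](measureDI m mA mI) setDE [X in (X + _)%E](_ : _ = 0%E) ?add0e//.
apply: (@subset_measure0 _ _ _ m _ (~` `[0, 1]%classic)) => //.
- by apply: measurableI => //; exact: measurableC.
- exact: measurableC.
- by have := probability_setC m mI; rewrite [X in (_ - X)%E]hm subee.
Qed.

Section tail_function.
Context (R : realType) (m : probability (measurableTypeR R) R).

Lemma EFin_tail a : (tail m a)%:E = m `]a, 1]%classic.
Proof. by rewrite /tail fineK// fin_num_measure. Qed.

Lemma tail_ge0 a : 0 <= tail m a.
Proof. by rewrite -lee_fin EFin_tail. Qed.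

Lemma tail_le1 a : tail m a <= 1.
Proof. by rewrite -lee_fin EFin_tail probability_le1//; exact: measurable_itv. Qed.

Lemma tail_ge1 a : 1 <= a -> tail m a = 0.
Proof. by move=> a1; rewrite /tail set_itv_ge ?measure0// bnd_simp -leNgt. Qed.

Lemma tail_nonincreasing : {homo tail m : a b / a <= b >-> b <= a}.
Proof.
move=> a b ab; rewrite -lee_fin !EFin_tail; apply: le_measure.
- by rewrite inE; exact: measurable_itv.
- by rewrite inE; exact: measurable_itv.
- by apply: subset_itvr; rewrite bnd_simp.
Qed.

Lemma measurable_tail : measurable_fun [set: measurableTypeR R] (tail m).
Proof. exact: nonincreasing_measurable tail_nonincreasing. Qed.

Hypothesis hm : on01 m.

Lemma measure_ray a : 0 <= a -> m `]a, +oo[%classic = (tail m a)%:E.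
Proof.
move=> a0; rewrite EFin_tail -(on01_setI hm); last exact: measurable_itv.
congr (m _); apply/seteqP; split=> x/=; rewrite !in_itv/= ?andbT.
  by move=> [-> /andP[_ ->]].
by move=> /andP[ax ->]; rewrite ax (le_trans a0 (ltW ax)).
Qed.

Lemma measure_ray_lt0 a : a < 0 -> m `]a, +oo[%classic = 1%E.
Proof.
move=> a0; apply/eqP; rewrite eq_le probability_le1/=; last first.
  exact: measurable_itv.
rewrite -[X in (X <= _)%E]hm le_measure// ?inE; [exact: measurable_itv..|].
by move=> x/=; rewrite !in_itv/= andbT => /andP[/(lt_le_trans a0)].
Qed.

(** Links [cdf01], the form in which eta enters [Lrel], with [tail], the form in which [tail_inj]
    compares laws. *)
Lemma tail_cdf01 u : 0 <= u <= 1 -> tail m u = 1 - cdf01 m u.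
Proof.
move=> /andP[u0 u1]; apply: EFin_inj.
rewrite EFinB EFin_tail fineK ?fin_num_measure//.
have mA : measurable (`[0, u]%classic : set (measurableTypeR R)).
  exact: measurable_itv.
have mB : measurable (`]u, 1]%classic : set (measurableTypeR R)).
  exact: measurable_itv.
have -> : (1 = m `[0%R, u]%classic + m `]u, 1%R]%classic :> \bar R)%E.
  rewrite -measureU//; last first.
    apply/seteqP; split=> x//=; rewrite !in_itv/= => -[/andP[_ xu] /andP[ux _]].
    by move: (lt_le_trans ux xu); rewrite ltxx.
  rewrite -[LHS]hm; congr (m _); apply/seteqP; split=> x/=; rewrite !in_itv/=.
    by move=> /andP[-> ->]; rewrite andbT; have [xu|ux] := leP x u; [left|right].
  move=> [/andP[-> /le_trans->//]|/andP[ux ->]].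
  by rewrite andbT (le_trans u0 (ltW ux)).
by rewrite addeAC subee ?add0e// fin_num_measure.
Qed.

End tail_function.

(** The rays ]x, +oo[ form a pi-system generating the Borel sets. Rays starting below 0 have mass 1
    and rays starting beyond 1 have mass 0, so the tails on [0,1] decide everything. *)
Lemma tail_inj (R : realType) (m1 m2 : probability (measurableTypeR R) R) :
  on01 m1 -> on01 m2 -> (forall t, 0 <= t <= 1 -> tail m1 t = tail m2 t) ->
  same_law m1 m2.
Proof.
move=> h1 h2 tt A mA.
have m12 x : m1 `]x, +oo[%classic = m2 `]x, +oo[%classic.
  have [x0|x0] := leP 0 x; last by rewrite !measure_ray_lt0.
  rewrite !measure_ray//; have [x1|x1] := leP x 1; first by rewrite tt// x0.
  by rewrite !tail_ge1// ltW.
apply: (@measure_unique _ R (measurableTypeR R) (@RGenOInfty.G R)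
  (fun n => `](- n%:R), +oo[%classic) _ _ _ _ m1 m2) => //.
- exact: RGenOInfty.measurableE.
- move=> _ _ [x ->] [y ->]; exists (Num.max x y).
  by apply/seteqP; split=> z/=; rewrite !in_itv/= !andbT gt_max;
    [case=> -> ->|move=> /andP[]].
- by move=> i; exists (- i%:R).
- rewrite -subTset => x _; exists (Num.bound `|x|) => //=.
  rewrite in_itv/= andbT ltrNl (le_lt_trans (ler_norm _))// normrN.
  exact: archi_boundP.
- by move=> _ [x ->]; exact: m12.
- move=> k; apply: le_lt_trans (ltry 1); apply: probability_le1.
  exact: measurable_itv.
Qed.

Lemma eq_first_moment (R : realType)
    (m1 m2 : probability (measurableTypeR R) R) :
  same_law m1 m2 -> first_moment m1 = first_moment m2.
Proof. by move=> h; apply: eq_measure_integral => A mA _; exact: h. Qed.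

(** * First moment and generalized inverse of a tail *)

Section first_moment_and_right_continuity.
Context (R : realType) (m : probability (measurableTypeR R) R) (hm : on01 m).

Lemma first_moment_tail :
  (first_moment m = \int[lebesgue_measure]_(t in `[0%R, 1%R]) (tail m t)%:E)%E.
Proof.
(* The layer-cake formula [ge0_expectation_ccdf] asks for a variable nonnegative everywhere; the
   positive part agrees with the identity on [0,1], which carries [m]. *)
pose f (x : measurableTypeR R) : R := Num.max x 0.
have mf : measurable_fun setT f by exact: measurable_maxr.
pose mixin := isMeasurableFun.Build _ _ _ _ f mf.
pose X : {RV m >-> R} := HB.pack f mixin.
transitivity ('E_m[X])%E.
  have mI : measurable (`[0, 1]%classic : set (measurableTypeR R)).
    exact: measurable_itv.
  rewrite expectation_def.
  rewrite (@ge0_negligible_integral _ _ _ m _ (~` `[0, 1]%classic))//.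
  - rewrite setTD setCK; apply: eq_integral => x; rewrite inE/= in_itv/=.
    by move=> /andP[x0 _]; rewrite /X/= /f (max_idPl x0).
  - exact: measurableC.
  - exact/measurable_EFinP.
  - by move=> x _; rewrite lee_fin le_max lexx orbT.
  - by have := probability_setC m mI; rewrite [X in (_ - X)%E]hm subee.
rewrite ge0_expectation_ccdf; last by move=> x; rewrite le_max lexx orbT.
rewrite integral_mkcond [RHS]integral_mkcond; apply: eq_integral => r _.
rewrite !patchE !mem_setE !in_itv/= andbT; have [r0|//] := leP 0 r.
have -> : ccdf X r = (tail m r)%:E.
  rewrite -measure_ray//; congr (m _); apply/seteqP.
  by split=> x/=; rewrite !in_itv/= !andbT lt_max (ltNge r 0) r0 orbF.
(* The tail vanishes beyond 1, so integrating over [0, +oo[ or over [0,1] is the same. *)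
by case: (leP r 1) => //= r1; rewrite tail_ge1// ltW.
Qed.

Lemma tail_right_continuous (t c : R) : 0 <= t < 1 -> c < tail m t ->
  exists2 b, t < b < 1 & c < tail m b.
Proof.
move=> /andP[t0 t1] ct.
pose f (x : measurableTypeR R) : R := x.
have mf : measurable_fun setT f by exact: measurable_id.
pose mixin := isMeasurableFun.Build _ _ _ _ f mf.
pose X : {RV m >-> R} := HB.pack f mixin.
have ccdfE x : 0 <= x -> ccdf X x = (tail m x)%:E by move=> x0; exact: measure_ray.
have : fine (ccdf X x) @[x --> t^'+] --> tail m t.
  by apply: fine_cvg; rewrite -ccdfE//; exact: ccdf_right_continuous.
move=> /cvgr_gt/(_ _ ct) Ht.
near t^'+ => b; have tb : t < b by near: b; exact: nbhs_right_gt.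
exists b; first by rewrite tb/=; near: b; exact: nbhs_right_lt.
rewrite -[ltRHS]/(fine (tail m b)%:E) -ccdfE; last by rewrite ltW// (le_lt_trans t0).
by near: b.
Unshelve. all: by end_near. Qed.

Lemma geninv_has_ubound (S : R -> R) (t : R) :
  has_ubound [set a : R | 0 <= a <= 1 /\ t < S a].
Proof. by exists 1 => a /= [/andP[]]. Qed.

(** From left to right, monotonicity of the tail suffices. From right to left, [t] itself lies in
    the set, but a strict inequality with the supremum needs a point beyond [t], which right
    continuity supplies. *)
Lemma lt_geninv_tail (a t : R) : 0 <= a -> 0 <= t <= 1 ->
  (t < geninv (tail m) a) = (a < tail m t).
Proof.
move=> a0 /andP[t0 t1]; apply/idP/idP => [|at_].
  have [E|/set0P ne] :=
      eqVneq [set b : R | 0 <= b <= 1 /\ a < tail m b] set0.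
    by rewrite /geninv E sup0 ltNge t0.
  move=> /(sup_gt ne)[b [_ ab] tb].
  exact: lt_le_trans ab (tail_nonincreasing m (ltW tb)).
(* The tail is 0 at 1, hence cannot exceed [a] there. *)
have t1' : t < 1.
  rewrite lt_neqAle t1 andbT; apply: contraTneq at_ => ->.
  by rewrite tail_ge1// -leNgt.
have [|b /andP[tb b1] ab] := tail_right_continuous _ at_; first by rewrite t0.
apply: (lt_le_trans tb); apply: ub_le_sup; first exact: geninv_has_ubound.
by split=> //; rewrite (le_trans t0 (ltW tb)) ltW.
Qed.

(** By [lt_geninv_tail], the set whose supremum is taken is [0, tail m t[. [S] is only known on
    [0,1], as [Lrel] says nothing outside it. *)
Lemma geninv_geninv_tail (S : R -> R) (t : R) :
  (forall a, 0 <= a <= 1 -> S a = geninv (tail m) a) -> 0 <= t <= 1 ->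
  geninv S t = tail m t.
Proof.
move=> SE t01; rewrite /geninv.
have -> : [set a | 0 <= a <= 1 /\ t < S a] = `[0, tail m t[%classic.
  apply/seteqP; split=> a/=; rewrite in_itv/=.
    move=> [a01]; case/andP: (a01) => a0 _; rewrite SE// lt_geninv_tail//.
    by rewrite a0.
  move=> /andP[a0 at_].
  have a01 : 0 <= a <= 1 by rewrite a0 (le_trans (ltW at_))// tail_le1.
  by rewrite SE// lt_geninv_tail.
(* If the tail is 0 at [t], the interval is empty and the convention on the empty supremum gives the
   right value. *)
have := tail_ge0 m t; rewrite le_eqVlt => /predU1P[<-|t_gt0].
  by rewrite set_itvco0 sup0.
by rewrite sup_itv// bnd_simp.
Qed.

End first_moment_and_right_continuity.

(** * The uniform law and Lebesgue measure *)

Lemma uniform_prob01E (R : realType) (A : set R) : measurable A ->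
  A `<=` `[0, 1]%classic -> uniform_prob (@ltr01 R) A = lebesgue_measure A.
Proof.
move=> mA A01; rewrite /uniform_prob integral_uniform_pdf setIidl//.
rewrite (eq_integral (cst 1%E)) ?integral_cst ?mul1e// => x; rewrite inE => /A01.
by rewrite /= in_itv/= /uniform_pdf => ->; rewrite subr0 invr1.
Qed.

(** [A] is squeezed between [0, sup A[ and [0, sup A], which have the same Lebesgue measure; it is
    measurable because it is an interval. *)
Lemma lebesgue_measure_initial_segment (R : realType) (A : set R) :
  A `<=` `[0, 1]%classic -> (forall a b, A b -> 0 <= a <= b -> A a) ->
  measurable A /\ lebesgue_measure A = (sup A)%:E.
Proof.
move=> A01 Adown.
have [->|/set0P [a0 Aa0]] := eqVneq A set0.
  by rewrite measure0 sup0; split => //; exact: measurable0.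
have Aub : has_ubound A by exists 1 => x /A01/=; rewrite in_itv/= => /andP[].
have supA0 : 0 <= sup A.
  apply: le_trans (ub_le_sup Aub Aa0).
  by have /= := A01 _ Aa0; rewrite in_itv/= => /andP[].
have mA : measurable A.
  apply: is_interval_measurable => x y Ax Ay z /andP[xz zy].
  apply: (Adown _ y) => //; rewrite zy andbT (le_trans _ xz)//.
  by have /= := A01 _ Ax; rewrite in_itv/= => /andP[].
split => //; apply/eqP; rewrite eq_le; apply/andP; split.
  apply: (@le_trans _ _ (lebesgue_measure `[0, sup A]%classic)); last first.
    by rewrite lebesgue_measure_itv/= lte_fin oppr0 adde0; case: ifP.
  apply: le_measure; rewrite ?inE//.
  move=> x Ax; rewrite /= in_itv/= ub_le_sup// andbT.
  by have /= := A01 _ Ax; rewrite in_itv/= => /andP[].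
apply: (@le_trans _ _ (lebesgue_measure `[0, sup A[%classic)).
  rewrite lebesgue_measure_itv/= lte_fin oppr0 adde0; case: ifPn => //.
  by rewrite -leNgt lee_fin.
apply: le_measure; rewrite ?inE//.
move=> x; rewrite /= in_itv/= => /andP[x0 xs].
have [||y Ay xy] := @sup_gt _ A x; [by exists a0|by []|].
by apply: (Adown _ y) => //; rewrite x0 ltW.
Qed.

Lemma cdf01_uniform (R : realType) (eta : probability (measurableTypeR R) R)
    (u : R) : uniform01 eta -> 0 <= u <= 1 -> cdf01 eta u = u.
Proof.
move=> ueta /andP[u0 u1].
rewrite /cdf01 ueta; last exact: measurable_itv.
rewrite uniform_prob01E; last by apply: subset_itvl; rewrite bnd_simp.
  rewrite lebesgue_measure_itv/= lte_fin oppr0 adde0.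
  by move: u0; rewrite le_eqVlt => /predU1P[<-|->//]; rewrite ltxx.
exact: measurable_itv.
Qed.

Lemma on01_uniform_prob (R : realType) :
  on01 (uniform_prob (@ltr01 R) : probability (measurableTypeR R) R).
Proof.
by rewrite /on01 /= uniform_prob01E// lebesgue_measure_itv/= lte01 oppr0 adde0.
Qed.

(** * The law of the tail evaluated at a uniform variable *)

Section tail_law.
Context (R : realType) (m : probability (measurableTypeR R) R).

Let mixin := isMeasurableFun.Build _ _ (measurableTypeR R) (measurableTypeR R)
  (tail m) (measurable_tail m).
Let X : {RV uniform_prob (@ltr01 R) >-> measurableTypeR R} :=
  HB.pack (tail m : measurableTypeR R -> measurableTypeR R) mixin.

Definition tail_law : probability (measurableTypeR R) R :=
  distribution (uniform_prob (@ltr01 R)) X.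

Lemma on01_tail_law : on01 tail_law.
Proof.
rewrite /on01 -(probability_setT (uniform_prob (@ltr01 R))).
congr (uniform_prob _ _); apply/seteqP; split=> // x _.
by rewrite /= in_itv/= tail_ge0 tail_le1.
Qed.

Lemma tail_tail_law t : 0 <= t <= 1 -> tail tail_law t = geninv (tail m) t.
Proof.
move=> /andP[t0 t1].
pose A := [set a : R | 0 <= a <= 1 /\ t < tail m a].
have A01 : A `<=` `[0, 1]%classic by move=> a [a01 _]; rewrite /= in_itv.
have [] := lebesgue_measure_initial_segment A01.
  move=> a b [/andP[b0 b1] tb] /andP[a0 ab]; split.
    by rewrite a0 (le_trans ab).
  exact: lt_le_trans tb (tail_nonincreasing m ab).
move=> mA muA; apply: EFin_inj; rewrite EFin_tail -[RHS]muA -uniform_prob01E//.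
have mpre : measurable (tail m @^-1` `]t, 1]%classic).
  by rewrite -[X in measurable X]setTI; exact: measurable_tail.
apply: etrans (esym (on01_setI (@on01_uniform_prob R) mpre)) _.
congr (uniform_prob _ _); apply/seteqP; split=> x; rewrite /A /= !in_itv/=.
  by move=> [/andP[tx _] ->].
by move=> [-> ->]; rewrite tail_le1.
Qed.

Lemma first_moment_tail_law : on01 m -> first_moment tail_law = first_moment m.
Proof.
move=> hm; rewrite (first_moment_tail hm) /first_moment.
rewrite ge0_integral_pushforward//; last first.
  by move=> x; rewrite inE/= in_itv/= lee_fin => /andP[].
have -> : tail m @^-1` `[0, 1]%classic = setT.
  by apply/seteqP; split=> // x _; rewrite /= in_itv/= tail_ge0 tail_le1.
rewrite integral_uniform//; last by move=> x; rewrite lee_fin tail_ge0.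
  by rewrite subr0 invr1 mul1e.
by apply/measurable_EFinP; exact: measurable_tail.
Qed.

Lemma Lrel_tail_law (eta : probability (measurableTypeR R) R) :
  uniform01 eta -> Lrel eta m tail_law.
Proof.
move=> ueta; split=> [|t t01]; first exact: on01_tail_law.
(* K(u) = u is only available for u in [0,1]; the generalized inverse stays there because it is
   itself a tail. *)
rewrite tail_tail_law// cdf01_uniform// -tail_tail_law//.
by rewrite tail_ge0 tail_le1.
Qed.

End tail_law.

(** * Images under the operator: uniqueness, the uniform case, Dirac masses *)

Lemma Lrel_unique (R : realType) (eta m m1 m2 : probability (measurableTypeR R) R) :
  Lrel eta m m1 -> Lrel eta m m2 -> same_law m1 m2.
Proof. by move=> [h1 t1] [h2 t2]; apply: tail_inj => // t t01; rewrite t1 ?t2. Qed.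

Lemma Lrel_uniform_tail (R : realType)
    (eta m m' : probability (measurableTypeR R) R) (t : R) :
  uniform01 eta -> Lrel eta m m' -> 0 <= t <= 1 ->
  tail m' t = geninv (tail m) t.
Proof.
move=> ueta [_ mm'] t01; rewrite mm'// cdf01_uniform// -tail_tail_law//.
by rewrite tail_ge0 tail_le1.
Qed.

(** On [0,1] the tail of the Dirac mass is the indicator of [0, x[, so all levels [t] below 1 cut
    out the same set. At level 1 the set would be empty. *)
Lemma geninv_tail_dirac (R : realType) (x t : R) : 0 <= x <= 1 -> 0 <= t < 1 ->
  geninv
    (tail (\d_(x : measurableTypeR R) : probability (measurableTypeR R) R)) t = x.
Proof.
move=> /andP[x0 x1] /andP[t0 t1]; rewrite /geninv.
have -> : [set a | 0 <= a <= 1 /\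
    t < tail (\d_(x : measurableTypeR R) : probability (measurableTypeR R) R) a]
    = `[0, x[%classic.
  apply/seteqP; split=> a; rewrite /= in_itv/= /tail /dirac/= indicE
    mem_setE in_itv/= x1 andbT.
    by move=> [/andP[-> _]]; case: (a < x) => //; rewrite ltNge t0.
  by move=> /andP[-> ax]; rewrite ax/= (ltW (lt_le_trans ax x1)).
move: x0; rewrite le_eqVlt => /predU1P[<-|x_gt0]; last first.
  by rewrite sup_itv// bnd_simp.
by rewrite set_itvco0 sup0.
Qed.

(* The image of the Dirac mass at x has constant tail K(x) on [0,1[, hence
   first moment K(x). *)
Lemma cdf01_of_first_moment (R : realType)
    (eta : probability (measurableTypeR R) R) (x : R) : Ldefined eta ->
  (forall m m' : probability (measurableTypeR R) R,
    on01 m -> Lrel eta m m' -> first_moment m = first_moment m') ->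
  0 <= x <= 1 -> cdf01 eta x = x.
Proof.
move=> def mom x01; pose m : probability (measurableTypeR R) R :=
    \d_(x : measurableTypeR R).
have x_in : x \in (`[0, 1]%classic : set R) by rewrite inE/= in_itv.
have hm : on01 m by rewrite /on01 /m /= diracE x_in.
have [m' mm'] := def m hm; have [hm' tm'] := mm'.
apply: EFin_inj; transitivity (first_moment m').
  (* The endpoint 1, where [geninv_tail_dirac] does not apply, is dropped from the domain of
     integration. *)
  rewrite first_moment_tail// -integral_itv_bndo_bndc; last first.
    by apply/measurable_funTS/measurable_EFinP; exact: measurable_tail.
  rewrite (eq_integral (cst (cdf01 eta x)%:E)).
    rewrite integral_cst//= lebesgue_measure_itv/= lte_fin ltr01.
    by rewrite oppr0 adde0 mule1.
  move=> t; rewrite inE/= in_itv/= => /andP[t0 t1].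
  by rewrite tm' ?t0 ?(ltW t1)// geninv_tail_dirac ?t0.
rewrite -(mom _ _ hm mm') /first_moment integral_dirac//.
by rewrite diracE x_in mul1e.
Qed.

Theorem proposition1 (R : realType)
    (eta : probability (measurableTypeR R) R) (heta : on01 eta) :
  ((Ldefined eta /\
    forall m m' : probability (measurableTypeR R) R,
      on01 m -> Lrel eta m m' -> first_moment m = first_moment m')
   <-> uniform01 eta)
  /\
  (uniform01 eta ->
    Ldefined eta /\
    forall m m' m'' : probability (measurableTypeR R) R,
      on01 m -> Lrel eta m m' -> Lrel eta m' m'' -> same_law m'' m).
Proof.
have def : uniform01 eta -> Ldefined eta.
  by move=> ueta m _; exists (tail_law m); exact: Lrel_tail_law.
split; [split=> [[Ldef mom]|ueta]|move=> ueta]; last 2 first.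
- split=> [|m m' hm mm']; first exact: def.
  (* By uniqueness of the image, [m'] has the law [tail_law m], whose first moment is known. *)
  rewrite -(first_moment_tail_law hm); apply: eq_first_moment.
  exact: Lrel_unique (Lrel_tail_law m ueta) mm'.
- split=> [|m m' m'' hm mm' m'm'']; first exact: def.
  apply: tail_inj => //; first by case: m'm''.
  move=> t t01; rewrite (Lrel_uniform_tail ueta m'm'')//.
  apply: geninv_geninv_tail => // a a01; exact: Lrel_uniform_tail ueta mm' a01.
(* Both eta and the uniform law have cumulative distribution function u on [0,1], hence equal
   tails. *)
- have hu := @on01_uniform_prob R.
  apply: tail_inj => // t t01; rewrite !tail_cdf01//.
  by rewrite cdf01_of_first_moment// cdf01_uniform.
Qed.
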